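(* Let $d\in\mathbb{N}$ and let $F\in GL_d(\mathbb{C})$ be a generic matrix, i.e. the eigenvalues of $F^*F$ are pairwise distinct. Then the universal unitary quantum group $U_F^+$ (i.e. the augmented algebra $(\mathrm{Pol}(U_F^+),\epsilon)$) has property (GC), hence also property (LK).
   Context: For a matrix $a=(a_{jk})$ over a $^*$-algebra, $a^t=(a_{kj})$, $\bar a=(a_{jk}^* )$, $a^*=\bar a^t$. $\mathrm{Pol}(U_F^+)$ is the universal unital $^*$-algebra generated by $u_{jk}$, $1\le j,k\le d$, subject to the relations that $u=(u_{jk})$ is unitary ($uu^*=u^*u=I$) and $F\bar uF^{-1}$ is unitary. Its character (counit) $\epsilon:\mathrm{Pol}(U_F^+)\to\mathbb{C}$ is the unital $^*$-homomorphism with $\epsilon(u_{jk})=\delta_{jk}$. Let $A$ be a unital $^*$-algebra with a character $\epsilon$, generated as a $^*$-algebra by the entries of a unitary matrix. Inner products are linear in the second argument; a representation on a Hilbert space $H$ means a unital $^*$-representation $\rho:A\to B(H)$. A $\rho$-$\epsilon$-cocycle is a linear map $\eta:A\to H$ with $\eta(ab)=\rho(a)\eta(b)+\eta(a)\epsilon(b)$. A Schürmann triple is $(\rho,\eta,\psi)$ with $\rho$ a representation, $\eta$ a $\rho$-$\epsilon$-cocycle and $\psi:A\to\mathbb{C}$ linear with $\psi(ab)=\psi(a)\epsilon(b)+\epsilon(a)\psi(b)+\langle\eta(a^* ),\eta(b)\rangle$ for all $a,b\in A$. A cocycle $\eta$ is Gaussian if $\rho=\epsilon(\cdot)\,\mathrm{id}_H$,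 i.e. $\eta(ab)=\epsilon(a)\eta(b)+\eta(a)\epsilon(b)$. A generating functional is a linear $\psi:A\to\mathbb{C}$ with $\psi(1)=0$, $\psi(a^* )=\overline{\psi(a)}$ and $\psi(a^*a)\ge0$ for $a\in\ker\epsilon$. Every generating functional $\psi$ is part of a Schürmann triple $(\rho,\eta,\psi)$ with $\eta(A)$ dense in $H$, unique up to unitary equivalence (the associated triple). Put $H_G=\{\xi\in H:\rho(a)\xi=\epsilon(a)\xi\ \forall a\in A\}$, $P_G$ the orthogonal projection onto $H_G$, $\rho_G=\rho|_{H_G}$, $\rho_N=\rho|_{H_G^\perp}$, $\eta_G=P_G\eta$, $\eta_N=(I-P_G)\eta$. One says $\psi$ admits a Lévy–Khintchine decomposition if there exist generating functionals $\psi_G,\psi_N$ such that $(\rho_G,\eta_G,\psi_G)$ and $(\rho_N,\eta_N,\psi_N)$ are Schürmann triples. Property (LK): every generating functional on $(A,\epsilon)$ admits a Lévy–Khintchine decomposition. Property (GC): every Gaussian cocycle $\eta:A\to H$ (any Hilbert space $H$) can be completed to a Schürmann triple $(\epsilon(\cdot)\mathrm{id},\eta,\psi)$. *)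

(* Defs.v *)
From HB Require Import structures.
From mathcomp Require Import all_boot all_order all_algebra.
From mathcomp Require Import all_classical all_reals all_analysis.
From mathcomp Require Export complex.
Set Implicit Arguments.
Unset Strict Implicit.
Unset Printing Implicit Defensive.
Import Order.TTheory GRing.Theory Num.Theory.
Import numFieldNormedType.Exports.
Local Open Scope classical_set_scope.
Local Open Scope ring_scope.

(* The theory is developed over a numClosedFieldType C, with conjugation z^*;
   the intended instance is C := R[i] for R : realType. *)

HB.mixin Record Algebra_hasStar (C : numClosedFieldType) A
    of GRing.Algebra C A := {
  star : A -> A;
  starK : involutive star;
  starD : forall x y, star (x + y) = star x + star y;
  starZ : forall (c : C) x, star (c *: x) = c^* *: star x;
  starM : forall x y, star (x * y) = star y * star x
}.

#[short(type="starAlgType")]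
HB.structure Definition StarAlgebra (C : numClosedFieldType) :=
  {A of Algebra_hasStar C A & GRing.Algebra C A}.

Section RegularStar.
Variable C : numClosedFieldType.
Let conjZ (c : C) (x : C^o) : (c *: x : C)^* = c^* *: (x^* : C^o).
Proof. by rewrite /GRing.scale /= rmorphM. Qed.
Let conjM (x y : C^o) : (x * y : C)^* = (y^* : C) * x^*.
Proof. by rewrite rmorphM mulrC. Qed.
HB.instance Definition _ := Algebra_hasStar.Build C C^o
  (@conjCK C) (rmorphD Num.conj) conjZ conjM.
End RegularStar.

Section StarAlgebraTheory.
Variables (C : numClosedFieldType) (A : starAlgType C).

Lemma star1 : star (1 : A) = 1.
Proof. by rewrite -[LHS]mulr1 -[X in _ * X]starK -starM mulr1 starK. Qed.

Lemma star0 : star (0 : A) = 0.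
Proof. by rewrite -[0](scale0r (0 : A)) starZ conjC0 !scale0r. Qed.

Lemma star_alg (c : C) : star (c%:A : A) = (c^*)%:A.
Proof. by rewrite starZ star1. Qed.

Lemma star_sum (I : Type) (r : seq I) (P : pred I) (f : I -> A) :
  star (\sum_(i <- r | P i) f i) = \sum_(i <- r | P i) star (f i).
Proof. by apply: (big_morph (@star C A)); [exact: starD | exact: star0]. Qed.

Variable d : nat.

Definition bar_mx (u : 'M[A]_d) : 'M[A]_d := map_mx star u.
Definition adj_mx (u : 'M[A]_d) : 'M[A]_d := (bar_mx u)^T.
Definition alg_mx (M : 'M[C]_d) : 'M[A]_d := map_mx (fun c => c%:A) M.

Definition unitary_mx (u : 'M[A]_d) : Prop :=
  u *m adj_mx u = 1%:M /\ adj_mx u *m u = 1%:M.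

Definition PolU_relations (F : 'M[C]_d) (u : 'M[A]_d) : Prop :=
  unitary_mx u /\ unitary_mx (alg_mx F *m bar_mx u *m alg_mx (invmx F)).

Definition character (eps : A -> C) : Prop :=
  [/\ scalar eps, eps 1 = 1, forall a b, eps (a * b) = eps a * eps b
    & forall a, eps (star a) = (eps a)^*].

End StarAlgebraTheory.

Definition star_morphism (C : numClosedFieldType) (A B : starAlgType C)
    (f : A -> B) : Prop :=
  [/\ linear f, f 1 = 1, forall a b, f (a * b) = f a * f b
    & forall a, f (star a) = star (f a)].

(* Pol(U_F^+) is the quotient of the *-terms in the d^2 generators by the
   smallest congruence containing the axioms of unital *-algebras over C and
   the defining relations. The scalar c is the term Cst c, and scaling by c is
   multiplication by Cst c. *)

Inductive star_term (C : Type) (d : nat) : Type :=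
  | Gen of 'I_d & 'I_d
  | Cst of C
  | Add of star_term C d & star_term C d
  | Mul of star_term C d & star_term C d
  | Star of star_term C d.
Arguments Gen {C d}.
Arguments Cst {C d}.

HB.instance Definition _ C d := gen_eqMixin (star_term C d).
HB.instance Definition _ C d := gen_choiceMixin (star_term C d).

Section Presentation.
Variables (C : numClosedFieldType) (d : nat).
Local Notation term := (star_term C d).
Local Notation tmatrix := ('I_d -> 'I_d -> star_term C d).

Definition tmul (a b : tmatrix) : tmatrix := fun j k =>
  \big[@Add C d/Cst 0]_(l < d) Mul (a j l) (b l k).
Definition tbar (a : tmatrix) : tmatrix := fun j k => Star (a j k).
Definition tadj (a : tmatrix) : tmatrix := fun j k => Star (a k j).
Definition tscal (M : 'M[C]_d) : tmatrix := fun j k => Cst (M j k).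

Variable F : 'M[C]_d.

Definition FubarFV : tmatrix :=
  tmul (tmul (tscal F) (tbar Gen)) (tscal (invmx F)).

Inductive PolU_eq : term -> term -> Prop :=
  | PE_refl x : PolU_eq x x
  | PE_sym x y : PolU_eq x y -> PolU_eq y x
  | PE_trans x y z : PolU_eq x y -> PolU_eq y z -> PolU_eq x z
  | PE_Add x x' y y' :
      PolU_eq x x' -> PolU_eq y y' -> PolU_eq (Add x y) (Add x' y')
  | PE_Mul x x' y y' :
      PolU_eq x x' -> PolU_eq y y' -> PolU_eq (Mul x y) (Mul x' y')
  | PE_Star x x' : PolU_eq x x' -> PolU_eq (Star x) (Star x')
  | PE_addA x y z : PolU_eq (Add x (Add y z)) (Add (Add x y) z)
  | PE_addC x y : PolU_eq (Add x y) (Add y x)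
  | PE_add0 x : PolU_eq (Add (Cst 0) x) x
  | PE_addN x : PolU_eq (Add (Mul (Cst (-1)) x) x) (Cst 0)
  | PE_mulA x y z : PolU_eq (Mul x (Mul y z)) (Mul (Mul x y) z)
  | PE_mul1 x : PolU_eq (Mul (Cst 1) x) x
  | PE_mulDl x y z : PolU_eq (Mul (Add x y) z) (Add (Mul x z) (Mul y z))
  | PE_mulDr x y z : PolU_eq (Mul x (Add y z)) (Add (Mul x y) (Mul x z))
  | PE_CstC c x : PolU_eq (Mul (Cst c) x) (Mul x (Cst c))
  | PE_CstD c c' : PolU_eq (Add (Cst c) (Cst c')) (Cst (c + c'))
  | PE_CstM c c' : PolU_eq (Mul (Cst c) (Cst c')) (Cst (c * c'))
  | PE_starK x : PolU_eq (Star (Star x)) x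
  | PE_starD x y : PolU_eq (Star (Add x y)) (Add (Star x) (Star y))
  | PE_starM x y : PolU_eq (Star (Mul x y)) (Mul (Star y) (Star x))
  | PE_starC c : PolU_eq (Star (Cst c)) (Cst c^*)
  | PE_uuadj j k : PolU_eq (tmul Gen (tadj Gen) j k) (Cst (j == k)%:R)
  | PE_uadju j k : PolU_eq (tmul (tadj Gen) Gen j k) (Cst (j == k)%:R)
  | PE_vvadj j k :
      PolU_eq (tmul FubarFV (tadj FubarFV) j k) (Cst (j == k)%:R)
  | PE_vadjv j k :
      PolU_eq (tmul (tadj FubarFV) FubarFV j k) (Cst (j == k)%:R).

Section Eval.
Variables (B : starAlgType C) (v : 'M[B]_d).

Fixpoint eval (t : term) : B :=
  match t with
  | Gen j k => v j k
  | Cst c => c%:A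
  | Add x y => eval x + eval y
  | Mul x y => eval x * eval y
  | Star x => star (eval x)
  end.

Definition eval_mx (a : tmatrix) : 'M[B]_d := \matrix_(j, k) eval (a j k).

Lemma eval_tmul a b : eval_mx (tmul a b) = eval_mx a *m eval_mx b.
Proof.
apply/matrixP => j k; rewrite !mxE /tmul.
rewrite (@big_morph _ _ eval 0 +%R) //; last by rewrite /= scale0r.
by apply: eq_bigr => l _; rewrite !mxE.
Qed.

Lemma eval_tadj a : eval_mx (tadj a) = adj_mx (eval_mx a).
Proof. by apply/matrixP => j k; rewrite !mxE. Qed.

Lemma eval_Gen : eval_mx Gen = v.
Proof. by apply/matrixP => j k; rewrite !mxE. Qed.

Lemma eval_FubarFV :
  eval_mx FubarFV = alg_mx B F *m bar_mx v *m alg_mx B (invmx F).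
Proof.
rewrite !eval_tmul; congr (_ *m _ *m _); by apply/matrixP => j k; rewrite !mxE.
Qed.

Lemma eval_delta (a : tmatrix) j k :
  eval_mx a = 1%:M -> eval (a j k) = eval (Cst (j == k)%:R).
Proof. by move/matrixP/(_ j k); rewrite !mxE /= scaler_nat. Qed.

Lemma eval_sound (hv : PolU_relations F v) x y :
  PolU_eq x y -> eval x = eval y.
Proof.
case: hv => -[h1 h2] [h3 h4]; elim=> {x y} /=.
- by [].
- by [].
- by move=> x y z _ -> _ ->.
- by move=> x x' y y' _ -> _ ->.
- by move=> x x' y y' _ -> _ ->.
- by move=> x x' _ ->.
- by move=> x y z; rewrite addrA.
- by move=> x y; rewrite addrC.
- by move=> x; rewrite scale0r add0r.
- by move=> x; rewrite scaleN1r mulN1r addNr scale0r.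
- by move=> x y z; rewrite mulrA.
- by move=> x; rewrite scale1r mul1r.
- by move=> x y z; rewrite mulrDl.
- by move=> x y z; rewrite mulrDr.
- by move=> c x; rewrite mulr_algl mulr_algr.
- by move=> c c'; rewrite scalerDl.
- by move=> c c'; rewrite mulr_algl scalerA.
- by move=> x; rewrite starK.
- by move=> x y; rewrite starD.
- by move=> x y; rewrite starM.
- by move=> c; rewrite star_alg.
- by move=> j k; apply: eval_delta; rewrite eval_tmul eval_tadj eval_Gen.
- by move=> j k; apply: eval_delta; rewrite eval_tmul eval_tadj eval_Gen.
- by move=> j k; apply: eval_delta; rewrite eval_tmul eval_tadj eval_FubarFV.
- by move=> j k; apply: eval_delta; rewrite eval_tmul eval_tadj eval_FubarFV.
Qed.

End Eval.

Lemma PolU_relations1 :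
  F \in unitmx -> PolU_relations F (1%:M : 'M[C^o]_d).
Proof.
move=> hF.
have barE : bar_mx (1%:M : 'M[C^o]_d) = 1%:M.
  apply/matrixP => j k; rewrite !mxE; case: (j == k); [exact: star1|exact: star0].
have adjE : adj_mx (1%:M : 'M[C^o]_d) = 1%:M by rewrite /adj_mx barE trmx1.
have U1 : unitary_mx (1%:M : 'M[C^o]_d) by split; rewrite adjE mulmx1.
split=> //; rewrite barE mulmx1.
have algE M : alg_mx C^o M = M :> 'M[C]_d.
  by apply/matrixP => j k; rewrite mxE /GRing.scale /= mulr1.
suff -> : alg_mx C^o F *m alg_mx C^o (invmx F) = 1%:M by [].
by rewrite !algE; exact: mulmxV hF.
Qed.

Definition PolU_eqb : rel term := fun x y => `[< PolU_eq x y >].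

Lemma PolU_eqb_equiv : equiv_class_of PolU_eqb.
Proof.
split=> [x|x y|y x z].
- exact/asboolP/PE_refl.
- by apply/asboolP/asboolP; exact: PE_sym.
- by move=> /asboolP xy /asboolP yz; apply/asboolP; exact: PE_trans xy yz.
Qed.

Canonical PolU_equiv := EquivRelPack PolU_eqb_equiv.

End Presentation.

(* The proof that F is invertible is a parameter since the library's algebras
   satisfy 1 != 0. *)
Section PolU.
Local Open Scope quotient_scope.
Variables (C : numClosedFieldType) (d : nat) (F : 'M[C]_d).
Variable hF : F \in unitmx.
Local Notation term := (star_term C d).

Definition PolU of F \in unitmx := {eq_quot PolU_equiv F}.
Local Notation P := (PolU hF).
HB.instance Definition _ := Choice.on P.
HB.instance Definition _ := EqQuotient.on P.

Let cls (x : term) : P := \pi_P x.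

Lemma clsP x y : PolU_eq F x y <-> cls x = cls y.
Proof.
split=> [h|/eqmodP/asboolP //]; exact/eqmodP/asboolP.
Qed.

Lemma cls_repr (p : P) : cls (repr p) = p. Proof. exact: reprK. Qed.

Lemma repr_cls x : PolU_eq F (repr (cls x)) x.
Proof. by apply/clsP; rewrite cls_repr. Qed.

Lemma clsW (Q : P -> Prop) : (forall x, Q (cls x)) -> forall p, Q p.
Proof. by move=> h p; rewrite -(cls_repr p). Qed.

Definition padd (p q : P) : P := cls (Add (repr p) (repr q)).
Definition pmul (p q : P) : P := cls (Mul (repr p) (repr q)).
Definition pstar (p : P) : P := cls (Star (repr p)).
Definition pcst (c : C) : P := cls (Cst c).
Definition popp (p : P) : P := pmul (pcst (-1)) p.
Definition pscale (c : C) (p : P) : P := pmul (pcst c) p.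

Lemma paddE x y : padd (cls x) (cls y) = cls (Add x y).
Proof. by apply/clsP; apply: PE_Add; exact: repr_cls. Qed.
Lemma pmulE x y : pmul (cls x) (cls y) = cls (Mul x y).
Proof. by apply/clsP; apply: PE_Mul; exact: repr_cls. Qed.
Lemma pstarE x : pstar (cls x) = cls (Star x).
Proof. by apply/clsP; apply: PE_Star; exact: repr_cls. Qed.
Definition pE := (paddE, pmulE, pstarE).

Ltac by_eq := repeat (elim/clsW => ?); rewrite /popp /pscale /pcst ?pE;
  apply/clsP; by constructor.

Lemma paddA : associative padd. Proof. by_eq. Qed.
Lemma paddC : commutative padd. Proof. by_eq. Qed.
Lemma padd0 : left_id (pcst 0) padd. Proof. by_eq. Qed.
Lemma paddN : left_inverse (pcst 0) popp padd. Proof. by_eq. Qed.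
Lemma pmulA : associative pmul. Proof. by_eq. Qed.
Lemma pmul1 : left_id (pcst 1) pmul. Proof. by_eq. Qed.
Lemma pcstC c p : pmul (pcst c) p = pmul p (pcst c).
Proof. by elim/clsW: p => x; rewrite /pcst !pE; apply/clsP; constructor. Qed.
Lemma pmulr1 : right_id (pcst 1) pmul.
Proof. by move=> p; rewrite -pcstC pmul1. Qed.
Lemma pmulDl : left_distributive pmul padd. Proof. by_eq. Qed.
Lemma pmulDr : right_distributive pmul padd. Proof. by_eq. Qed.
Lemma pcstM c c' : pmul (pcst c) (pcst c') = pcst (c * c').
Proof. by rewrite /pcst pE; apply/clsP; constructor. Qed.
Lemma pcstD c c' : padd (pcst c) (pcst c') = pcst (c + c').
Proof. by rewrite /pcst pE; apply/clsP; constructor. Qed.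

Lemma p1_neq0 : pcst 1 != pcst 0.
Proof.
apply/eqP => /clsP /(eval_sound (PolU_relations1 hF)) /=.
by rewrite scale1r scale0r => /eqP; rewrite oner_eq0.
Qed.

HB.instance Definition _ := GRing.isZmodule.Build P paddA paddC padd0 paddN.
HB.instance Definition _ := GRing.Zmodule_isNzRing.Build P
  pmulA pmul1 pmulr1 pmulDl pmulDr p1_neq0.

Let pscaleA c c' p : pscale c (pscale c' p) = pscale (c * c') p.
Proof. by rewrite /pscale pmulA pcstM. Qed.
Let pscaleDr : right_distributive pscale +%R.
Proof. by move=> c p q; exact: pmulDr. Qed.
Let pscaleDl p : {morph pscale^~ p : c c' / c + c' >-> c + c'}.
Proof. by move=> c c'; rewrite /pscale -pcstD; exact: pmulDl. Qed.

HB.instance Definition _ := GRing.Zmodule_isLmodule.Build C P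
  pscaleA pmul1 pscaleDr pscaleDl.

Let pscaleAl (c : C) (p q : P) : c *: (p * q) = (c *: p) * q.
Proof. exact: pmulA. Qed.
HB.instance Definition _ := GRing.Lmodule_isLalgebra.Build C P pscaleAl.

Let pscaleAr (c : C) (p q : P) : c *: (p * q) = p * (c *: q).
Proof.
change (pmul (pcst c) (pmul p q) = pmul p (pmul (pcst c) q)).
by rewrite !pmulA (pcstC c p).
Qed.
HB.instance Definition _ := GRing.Lalgebra_isAlgebra.Build C P pscaleAr.

Let pstarK : involutive pstar. Proof. by_eq. Qed.
Let pstarD p q : pstar (p + q) = pstar p + pstar q.
Proof. by move: p q; change (forall p q, pstar (padd p q) = padd (pstar p) (pstar q)); by_eq. Qed.
Let pstarM p q : pstar (p * q) = pstar q * pstar p.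
Proof. by move: p q; change (forall p q, pstar (pmul p q) = pmul (pstar q) (pstar p)); by_eq. Qed.
Let pstarC c : pstar (pcst c) = pcst c^*.
Proof. by rewrite /pcst pE; apply/clsP; constructor. Qed.
Let pstarZ (c : C) (p : P) : pstar (c *: p) = c^* *: pstar p.
Proof.
rewrite -[LHS]/(pstar (pcst c * p)) pstarM pstarC.
by rewrite -[RHS]/(pmul (pcst c^*) (pstar p)) pcstC.
Qed.
HB.instance Definition _ := Algebra_hasStar.Build C P pstarK pstarD pstarZ pstarM.

Definition PolU_gen : 'M[P]_d := \matrix_(j, k) cls (Gen j k).

Lemma eval_PolU_gen x : eval PolU_gen x = cls x.
Proof.
elim: x => [j k|c|x IHx y IHy|x IHx y IHy|x IHx] /=.
- by rewrite mxE.
- exact: pmulr1.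
- by rewrite IHx IHy -paddE.
- by rewrite IHx IHy -pmulE.
- by rewrite IHx -pstarE.
Qed.

Lemma PolU_gen_relations : PolU_relations F PolU_gen.
Proof.
have key (a : 'I_d -> 'I_d -> term) :
    (forall j k, PolU_eq F (a j k) (Cst (j == k)%:R)) ->
    eval_mx PolU_gen a = 1%:M.
  move=> h; apply/matrixP => j k; rewrite !mxE eval_PolU_gen.
  by rewrite (iffLR (clsP _ _) (h j k)) -eval_PolU_gen /= scaler_nat.
rewrite /PolU_relations /unitary_mx -eval_FubarFV -{1 2 3 4}(eval_Gen PolU_gen).
rewrite -!eval_tadj -!eval_tmul.
by split; split; apply: key => j k; constructor.
Qed.

Lemma PolU_ind (Q : P -> Prop) :
    (forall j k, Q (PolU_gen j k)) -> (forall c : C, Q c%:A) ->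
    (forall a b, Q a -> Q b -> Q (a + b)) ->
    (forall a b, Q a -> Q b -> Q (a * b)) ->
    (forall a, Q a -> Q (star a)) -> forall a, Q a.
Proof.
move=> hG hC hA hM hS; elim/clsW => x; rewrite -eval_PolU_gen.
elim: x => [j k|c|x IHx y IHy|x IHx y IHy|x IHx] /=.
- exact: hG.
- exact: hC.
- exact: hA.
- exact: hM.
- exact: hS.
Qed.

Definition PolU_lift (B : starAlgType C) (v : 'M[B]_d) (p : P) : B :=
  eval v (repr p).

(* The universal property of Pol(U_F^+). *)
Section Lift.
Variables (B : starAlgType C) (v : 'M[B]_d).
Hypothesis hv : PolU_relations F v.

Lemma PolU_liftE x : PolU_lift v (cls x) = eval v x.
Proof. by apply: (eval_sound hv); exact: repr_cls. Qed.

Lemma PolU_lift_gen j k : PolU_lift v (PolU_gen j k) = v j k.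
Proof. by rewrite mxE PolU_liftE. Qed.

Lemma PolU_lift_morphism : star_morphism (PolU_lift v).
Proof.
have hM a b : PolU_lift v (a * b) = PolU_lift v a * PolU_lift v b.
  elim/clsW: a => x; elim/clsW: b => y.
  by rewrite -[_ * _]/(pmul _ _) pE !PolU_liftE.
have hC c : PolU_lift v (pcst c) = c%:A by rewrite PolU_liftE.
split=> [c a b||//|a].
- rewrite -[c *: a]/(pcst c * a).
  have hA p q : PolU_lift v (p + q) = PolU_lift v p + PolU_lift v q.
    elim/clsW: p => x; elim/clsW: q => y.
    by rewrite -[_ + _]/(padd _ _) pE !PolU_liftE.
  by rewrite hA hM hC mulr_algl.
- by rewrite -[1]/(pcst 1) hC scale1r.
- by elim/clsW: a => x; rewrite -[star _]/(pstar _) pE !PolU_liftE.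
Qed.

Lemma PolU_lift_unique (f : P -> B) :
  star_morphism f -> (forall j k, f (PolU_gen j k) = v j k) ->
  f =1 PolU_lift v.
Proof.
case=> fL f1 fM fS fG.
have [gL g1 gM gS] := PolU_lift_morphism.
have add (h : P -> B) : linear h -> {morph h : a b / a + b}.
  by move=> hL a b; rewrite -{1}[a]scale1r hL scale1r.
have alg (h : P -> B) c : linear h -> h 1 = 1 -> h (c%:A) = c%:A.
  move=> hL h1; have h0 : h 0 = 0.
    by apply: (addrI (h 0)); rewrite -add // !addr0.
  by rewrite -[c%:A]addr0 hL h0 addr0 h1.
elim/PolU_ind => [j k|c|a b Ha Hb|a b Ha Hb|a Ha].
- by rewrite PolU_lift_gen fG.
- by rewrite !alg.
- by rewrite !add // Ha Hb.
- by rewrite fM gM Ha Hb.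
- by rewrite fS gS Ha.
Qed.

End Lift.

Definition counit : P -> C := @PolU_lift C^o 1%:M.

Lemma counit_character : character counit.
Proof. exact: (PolU_lift_morphism (PolU_relations1 hF)). Qed.

Lemma counit_gen j k : counit (PolU_gen j k) = (j == k)%:R.
Proof. by rewrite /counit (PolU_lift_gen (PolU_relations1 hF)) mxE. Qed.

Lemma counit_unique (eps : P -> C) : character eps ->
  (forall j k, eps (PolU_gen j k) = (j == k)%:R) -> eps =1 counit.
Proof.
move=> heps hG; apply: (PolU_lift_unique (PolU_relations1 hF) heps) => j k.
by rewrite hG mxE.
Qed.

End PolU.
Arguments counit {C d F} hF p.

(* dot is linear in the second argument. *)
HB.mixin Record CompleteNormedModule_isHilbert (C : numClosedFieldType) H
    of CompleteNormedModule C H := {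
  dot : H -> H -> C;
  dotDr : forall x y z, dot x (y + z) = dot x y + dot x z;
  dotZr : forall (c : C) x y, dot x (c *: y) = c * dot x y;
  dot_conj : forall x y, dot y x = (dot x y)^*;
  dotxx : forall x, dot x x = `|x| ^+ 2
}.

#[short(type="hilbertType")]
HB.structure Definition Hilbert (C : numClosedFieldType) :=
  {H of CompleteNormedModule_isHilbert C H & CompleteNormedModule C H}.

Section Hilbert.
Variables (C : numClosedFieldType) (H : hilbertType C).

Definition closed_subspace (V : set H) : Prop :=
  [/\ V 0, forall (c : C) x y, V x -> V y -> V (c *: x + y) & closed V].

Definition orthocomplement (V : set H) : set H :=
  [set x | forall y, V y -> dot y x = 0].

(* The point y of V with x - y orthogonal to V, which exists and is unique
   when V is a closed subspace. *)
Definition orthoproj (V : set H) (x : H) : H :=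
  xget 0 [set y | V y /\ orthocomplement V (x - y)].

Definition bounded_operator (V : set H) (T : H -> H) : Prop :=
  [/\ forall x, V x -> V (T x),
      forall (c : C) x y, V x -> V y -> T (c *: x + y) = c *: T x + T y
    & exists M : C, forall x, V x -> `|T x| <= M * `|x|].

End Hilbert.

(* Representations, cocycles and Schurmann triples are on the Hilbert space
   given by a closed subspace V of H; V := setT gives those on H itself, and
   the restriction of rho to an invariant V is represented by rho, of which
   only the values on V are then constrained. *)
Section Schurmann.
Variables (C : numClosedFieldType) (A : starAlgType C) (eps : A -> C).

Section OnSubspace.
Variables (H : hilbertType C) (V : set H).

Record representation (rho : A -> H -> H) : Prop := {
  rep_space : closed_subspace V;
  rep_bounded : forall a, bounded_operator V (rho a);
  rep_linear : forall (c : C) a b x, V x ->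
    rho (c *: a + b) x = c *: rho a x + rho b x;
  rep1 : forall x, V x -> rho 1 x = x;
  repM : forall a b x, V x -> rho (a * b) x = rho a (rho b x);
  rep_star : forall a x y, V x -> V y ->
    dot (rho (star a) x) y = dot x (rho a y)
}.

Record cocycle (rho : A -> H -> H) (eta : A -> H) : Prop := {
  cocycle_in : forall a, V (eta a);
  cocycle_linear : linear eta;
  cocycleM : forall a b, eta (a * b) = rho a (eta b) + eps b *: eta a
}.

Record schurmann_triple (rho : A -> H -> H) (eta : A -> H) (psi : A -> C)
    : Prop := {
  schurmann_rep : representation rho;
  schurmann_cocycle : cocycle rho eta;
  schurmann_linear : scalar psi;
  schurmannM : forall a b,
    psi (a * b) = psi a * eps b + eps a * psi b + dot (eta (star a)) (eta b)
}.

End OnSubspace.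

Definition eps_rep (H : hilbertType C) (a : A) (x : H) : H := eps a *: x.

Definition gaussian_cocycle (H : hilbertType C) (eta : A -> H) : Prop :=
  cocycle setT (@eps_rep H) eta.

Definition generating_functional (psi : A -> C) : Prop :=
  [/\ scalar psi, psi 1 = 0, forall a, psi (star a) = (psi a)^*
    & forall a, eps a = 0 -> 0 <= psi (star a * a)].

Definition associated_triple (H : hilbertType C) (rho : A -> H -> H)
    (eta : A -> H) (psi : A -> C) : Prop :=
  schurmann_triple setT rho eta psi /\ dense (range eta).

Definition gaussian_space (H : hilbertType C) (rho : A -> H -> H) : set H :=
  [set x | forall a, rho a x = eps a *: x].

(* The associated triple is unique up to unitary equivalence, so the condition
   is required of every triple associated to psi. *)
Definition admits_LK (psi : A -> C) : Prop :=
  forall (H : hilbertType C) (rho : A -> H -> H) (eta : A -> H),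
    associated_triple rho eta psi ->
    let HG := gaussian_space rho in
    let etaG a := orthoproj HG (eta a) in
    let etaN a := eta a - orthoproj HG (eta a) in
    exists psiG psiN : A -> C,
      [/\ generating_functional psiG, generating_functional psiN,
          schurmann_triple HG rho etaG psiG
        & schurmann_triple (orthocomplement HG) rho etaN psiN].

Definition property_LK : Prop :=
  forall psi, generating_functional psi -> admits_LK psi.

Definition property_GC : Prop :=
  forall (H : hilbertType C) (eta : A -> H), gaussian_cocycle eta ->
    exists psi : A -> C, schurmann_triple setT (@eps_rep H) eta psi.

End Schurmann.

(* Eigenvalues are counted with algebraic multiplicity. *)
Definition generic_mx (C : numClosedFieldType) (d : nat) (F : 'M[C]_d) : Prop :=
  exists2 s : seq C,
    char_poly ((map_mx Num.conj F)^T *m F) = \prod_(x <- s) ('X - x%:P)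
    & uniq s.

(* Main.v *)
(* With Q = F^* F, the relations force the matrix (eta(u_kj))_{jk} of a Gaussian
   cocycle eta to commute with Q. As Q has simple spectrum, a unitary U that
   diagonalizes Q also diagonalizes that matrix, with diagonal vectors h_i in H.
   Completing eta to a Schuermann triple amounts to lifting it to a
   *-homomorphism into the algebra of operators [[t, <x|, p], [0, t, |y>],
   [0, 0, t]] on C + H + C. There the h_i exponentiate to unitaries b_i, and
   U^T diag(b) conj(U) satisfies the defining relations, because its entrywise
   conjugate commutes with Q; the universal property yields the lift, and its
   corner entry is the functional psi, which is hermitian.
   For (LK), the projection of a cocycle onto H_G is Gaussian; if psi_G
   completes it, then psi - psi_G completes the orthogonal part. *)
From HB Require Import structures.
Require Import Defs.
From mathcomp Require Import all_boot all_order all_algebra.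
From mathcomp Require Import all_classical all_reals all_analysis.
From mathcomp Require Import complex.
From mathcomp Require Import ring lra.
Set Implicit Arguments.
Unset Strict Implicit.
Unset Printing Implicit Defensive.
Import Order.TTheory GRing.Theory Num.Theory.
Import numFieldNormedType.Exports.
Local Open Scope classical_set_scope.
Local Open Scope ring_scope.

(** * Diagonalization of matrices with simple spectrum *)

Section GenericMatrix.
Variables (C : numClosedFieldType) (d : nat).
Implicit Types M N F U : 'M[C]_d.

Definition ctrmx M : 'M[C]_d := (map_mx Num.conj M)^T.

Lemma ctrmxM M N : ctrmx (M *m N) = ctrmx N *m ctrmx M.
Proof. by rewrite /ctrmx map_mxM trmx_mul. Qed.

Lemma ctrmxK : involutive ctrmx.
Proof. by move=> M; apply/matrixP => i j; rewrite !mxE conjCK. Qed.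

Lemma ctrmx1 : ctrmx 1%:M = 1%:M.
Proof. by rewrite /ctrmx map_mx1 trmx1. Qed.

Lemma char_poly_conjugate U V M :
  U *m V = 1%:M -> char_poly (U *m M *m V) = char_poly M.
Proof.
move=> UV; have VU := mulmx1C UV.
have UVp : map_mx polyC U *m map_mx polyC V = 1%:M.
  by rewrite -map_mxM UV map_mx1.
rewrite /char_poly /char_poly_mx.
have -> : 'X%:M - map_mx polyC (U *m M *m V) =
    map_mx polyC U *m ('X%:M - map_mx polyC M) *m map_mx polyC V.
  rewrite mulmxBr mulmxBl !map_mxM; congr (_ - _).
  by rewrite scalar_mxC -mulmxA UVp mulmx1.
by rewrite !det_mulmx mulrAC -det_mulmx UVp det1 mul1r.
Qed.

(** The matrix [ctrmx F *m F] is self-adjoint, hence normal, so a unitary diagonalizes it. Its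
    characteristic polynomial then compares the diagonal with the list [s]. *)
Lemma generic_spectral F : generic_mx F ->
  exists (U : 'M[C]_d) (D : 'rV[C]_d),
    [/\ U *m ctrmx U = 1%:M, ctrmx U *m U = 1%:M,
        ctrmx F *m F = ctrmx U *m diag_mx D *m U & injective (D 0)].
Proof.
case=> s; rewrite -/(ctrmx F) => cpE s_uniq.
set Q := ctrmx F *m F in cpE *.
have Qnormal : Q \is normalmx.
  by apply/normalmxP; rewrite -map_trmx -/(ctrmx Q) ctrmxM ctrmxK.
set U := spectralmx Q; set D := spectral_diag Q.
have QE : Q = invmx U *m diag_mx D *m U by exact/orthomx_spectralP.
have Uu : U \is unitarymx by exact: spectral_unitarymx.
have UV : U *m ctrmx U = 1%:M.
  by move/unitarymxP: (Uu); rewrite -map_trmx.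
have iU : invmx U = ctrmx U by rewrite invmx_unitary // -map_trmx.
rewrite iU in QE; have VU := mulmx1C UV.
exists U, D; split=> //.
have prodE : \prod_(x <- [seq D 0 i | i <- enum 'I_d]) ('X - x%:P) =
    \prod_(x <- s) ('X - x%:P).
  rewrite -cpE QE char_poly_conjugate //.
  rewrite char_poly_trig ?big_map ?big_enum /=; last exact: diag_mx_is_trig.
  by apply: eq_bigr => i _; rewrite mxE eqxx.
(* The diagonal and [s] give the same product of linear factors, hence have equal length and the
   same members; as [s] is free of repetitions, so is the diagonal. *)
have : uniq [seq D 0 i | i <- enum 'I_d].
  rewrite (uniq_size_uniq s_uniq) => [|x].
    have := congr1 (fun p : {poly C} => size p) prodE.
    by rewrite !size_prod_XsubC => -[->].
  by rewrite -!root_prod_XsubC prodE.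
move/injectiveP; apply.
Qed.

(** The [(i, j)] entry of the commutator is [(D 0 j - D 0 i) * M i j]. *)
Lemma commute_diag_mx (D : 'rV[C]_d) M : injective (D 0) ->
  M *m diag_mx D = diag_mx D *m M -> forall i j, i != j -> M i j = 0.
Proof.
move=> Dinj /matrixP h i j ij; have := h i j.
rewrite mul_mx_diag mul_diag_mx !mxE => /eqP.
rewrite mulrC -subr_eq0 -mulrBl mulf_eq0 subr_eq0 => /orP[/eqP/Dinj ji|/eqP//].
by rewrite ji eqxx in ij.
Qed.

End GenericMatrix.

(** * Scalar conjugates of diagonal unitaries over a star-algebra *)

Section DiagonalRepresentation.
Variables (C : numClosedFieldType) (d : nat) (B : starAlgType C).
Implicit Types (M N : 'M[C]_d) (X Y : 'M[B]_d) (b : 'rV[B]_d).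
Local Notation alg := (alg_mx B).

Lemma alg_mxM M N : alg (M *m N) = alg M *m alg N.
Proof. exact: (map_mxM (in_alg B)). Qed.

Lemma alg_mx1 : alg (1%:M : 'M[C]_d) = 1%:M.
Proof. exact: (map_mx1 (in_alg B)). Qed.

Lemma adj_mxM X Y : adj_mx (X *m Y) = adj_mx Y *m adj_mx X.
Proof.
apply/matrixP => i j; rewrite !mxE star_sum; apply: eq_bigr => k _.
by rewrite starM !mxE.
Qed.

Lemma adj_alg_mx M : adj_mx (alg M) = alg (ctrmx M).
Proof. by apply/matrixP => i j; rewrite !mxE star_alg. Qed.

Lemma adj_diag_mx b : adj_mx (diag_mx b) = diag_mx (map_mx star b).
Proof.
apply/matrixP => i j; rewrite !mxE eq_sym.
by case: eqP => [->|_]; rewrite ?mulr1n ?mulr0n ?star0.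
Qed.

Lemma alg_diag_algE M b N i j :
  (alg M *m diag_mx b *m alg N) i j = \sum_k (M i k * N k j) *: b 0 k.
Proof.
rewrite mxE; apply: eq_bigr => k _; rewrite mul_mx_diag !mxE.
by rewrite mulr_algr mulr_algl scalerA mulrC.
Qed.

(** Over a noncommutative [B], transposition does not reverse products in general; here each summand
    of an entry has a single nonscalar factor [b 0 k]. *)
Lemma tr_alg_diag_alg M b N :
  (alg M *m diag_mx b *m alg N)^T = alg N^T *m diag_mx b *m alg M^T.
Proof.
apply/matrixP => i j; rewrite mxE !alg_diag_algE; apply: eq_bigr => k _.
by rewrite !mxE mulrC.
Qed.

Lemma unitary_diag_conjugate U V b : V *m U = 1%:M -> V = ctrmx U ->
  (forall i, b 0 i * star (b 0 i) = 1) ->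
  (forall i, star (b 0 i) * b 0 i = 1) ->
  unitary_mx (alg V *m diag_mx b *m alg U).
Proof.
move=> VU Vdef bb' b'b; have UV := mulmx1C VU.
have hV : alg V *m alg U = 1%:M by rewrite -alg_mxM VU alg_mx1.
have hU : alg U *m alg V = 1%:M by rewrite -alg_mxM UV alg_mx1.
rewrite /unitary_mx !adj_mxM !adj_alg_mx Vdef ctrmxK -Vdef adj_diag_mx.
have bB : diag_mx b *m diag_mx (map_mx star b) = 1%:M.
  apply/matrixP => i j; rewrite mul_mx_diag !mxE mulrnAl.
  by case: eqP => // ->; rewrite bb'.
have Bb : diag_mx (map_mx star b) *m diag_mx b = 1%:M.
  apply/matrixP => i j; rewrite mul_mx_diag !mxE mulrnAl.
  by case: eqP => // ->; rewrite b'b.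
split; rewrite -!mulmxA.
- by rewrite (mulmxA (alg U)) hU mul1mx (mulmxA (diag_mx b)) bB mul1mx.
- by rewrite (mulmxA (alg U)) hU mul1mx (mulmxA _ (diag_mx b)) Bb mul1mx.
Qed.

(* In the eigenbasis of F^* F, a diagonal unitary commutes with F^* F, so that
   conjugating it by F keeps it unitary. *)
Lemma diagonal_PolU_relations (F U : 'M[C]_d) (D : 'rV[C]_d) b :
  F \in unitmx -> U *m ctrmx U = 1%:M ->
  ctrmx F *m F = ctrmx U *m diag_mx D *m U ->
  (forall i, b 0 i * star (b 0 i) = 1) ->
  (forall i, star (b 0 i) * b 0 i = 1) ->
  PolU_relations F (alg U^T *m diag_mx b *m alg (map_mx Num.conj U)).
Proof.
move=> hF UV QE bb' b'b; have VU := mulmx1C UV.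
set v := _ *m _ *m _.
have vU : unitary_mx v.
  apply: unitary_diag_conjugate => //.
  - by rewrite -[_ *m _]trmxK trmx_mul trmxK -/(ctrmx U) VU trmx1.
  - by apply/matrixP => i j; rewrite !mxE conjCK.
split=> //.
set w := bar_mx v.
have wE : w = alg (ctrmx U) *m diag_mx (map_mx star b) *m alg U.
  rewrite /w -[bar_mx v]trmxK -/(adj_mx v) !adj_mxM adj_diag_mx !adj_alg_mx.
  rewrite mulmxA tr_alg_diag_alg; congr (alg _ *m _ *m alg _).
  - by apply/matrixP => i j; rewrite !mxE.
  - by apply/matrixP => i j; rewrite !mxE conjCK.
have [ww' w'w] : unitary_mx w.
  by rewrite wE; apply: unitary_diag_conjugate => // i; rewrite mxE starK.
have hUV : alg U *m alg (ctrmx U) = 1%:M by rewrite -alg_mxM UV alg_mx1.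
(* Both matrices are diagonal in the basis given by [U], and the scalar entries of [D] are central
   in [B]. *)
have wQ : w *m alg (ctrmx F *m F) = alg (ctrmx F *m F) *m w.
  rewrite QE wE !alg_mxM -!mulmxA; congr (_ *m _).
  rewrite !(mulmxA (alg U)) hUV !mul1mx !mulmxA; congr (_ *m _).
  have -> : alg (diag_mx D) = diag_mx (map_mx (in_alg B) D).
    apply/matrixP => i j; rewrite !mxE.
    by case: eqP => _; rewrite ?mulr1n ?mulr0n ?scale0r.
  apply/matrixP => i j; rewrite !mul_mx_diag !mxE.
  case: eqP => [->|_]; rewrite ?mulr0n ?mul0r // !mulr1n.
  by rewrite /= mulr_algl mulr_algr.
have FVF : alg (invmx F) *m alg F = 1%:M by rewrite -alg_mxM mulVmx // alg_mx1.
have FFV : alg F *m alg (invmx F) = 1%:M by rewrite -alg_mxM mulmxV // alg_mx1.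
set G := ctrmx F in wQ *; set GV := ctrmx (invmx F).
have GVG : alg GV *m alg G = 1%:M.
  by rewrite -alg_mxM -ctrmxM mulmxV // ctrmx1 alg_mx1.
have GGV : alg G *m alg GV = 1%:M.
  by rewrite -alg_mxM -ctrmxM mulVmx // ctrmx1 alg_mx1.
rewrite alg_mxM in wQ.
(* With Q = G F, the inverse of Q is [invmx F *m GV], so [w] commutes with it too. In [F w F^-1]
   times its adjoint, [w] moves past Q^-1 to meet its adjoint; in the opposite product it moves past
   Q. *)
have wQV : w *m (alg (invmx F) *m alg GV) = alg (invmx F) *m alg GV *m w.
  have QVQ : alg (invmx F) *m alg GV *m (alg G *m alg F) = 1%:M.
    by rewrite mulmxA -(mulmxA (alg (invmx F))) GVG mulmx1 FVF.
  rewrite -[LHS]mul1mx -QVQ.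
  rewrite -(mulmxA (alg (invmx F) *m alg GV)); congr (_ *m _).
  rewrite mulmxA -wQ -mulmxA mulmxA -!mulmxA (mulmxA (alg F)) FFV mul1mx.
  by rewrite GGV mulmx1.
split; rewrite !adj_mxM !adj_alg_mx -/G -/GV -!mulmxA.
- rewrite (mulmxA (alg (invmx F))) (mulmxA w) wQV -!mulmxA (mulmxA w) ww' mul1mx.
  by rewrite GVG mulmx1.
- rewrite (mulmxA (alg G)) (mulmxA (alg G *m alg F)) -wQ -!mulmxA FFV mulmx1.
  by rewrite (mulmxA (adj_mx w)) w'w mul1mx GVG.
Qed.

End DiagonalRepresentation.

(** * Elementary properties of the inner product *)

Section HilbertTheory.
Variables (C : numClosedFieldType) (H : hilbertType C).
Implicit Types (x y z : H) (c : C).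

Lemma dotDl x y z : dot (x + y) z = dot x z + dot y z.
Proof. by rewrite dot_conj dotDr rmorphD /= -!dot_conj. Qed.

Lemma dotZl c x y : dot (c *: x) y = c^* * dot x y.
Proof. by rewrite dot_conj dotZr rmorphM /= -dot_conj. Qed.

Lemma dot0r x : dot x 0 = 0.
Proof. by rewrite -(scale0r (0 : H)) dotZr mul0r. Qed.

Lemma dot0l x : dot 0 x = 0.
Proof. by rewrite dot_conj dot0r conjC0. Qed.

Lemma dotNr x y : dot x (- y) = - dot x y.
Proof. by rewrite -scaleN1r dotZr mulN1r. Qed.

Lemma dotNl x y : dot (- x) y = - dot x y.
Proof. by rewrite dot_conj dotNr rmorphN /= -dot_conj. Qed.

Lemma dotBr x y z : dot x (y - z) = dot x y - dot x z.
Proof. by rewrite dotDr dotNr. Qed.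

Lemma dot_sumr x (I : Type) (r : seq I) (P : pred I) (f : I -> H) :
  dot x (\sum_(i <- r | P i) f i) = \sum_(i <- r | P i) dot x (f i).
Proof. by apply: (big_morph (dot x)); [exact: dotDr | exact: dot0r]. Qed.

Lemma dot_eq0 x : dot x x = 0 -> x = 0.
Proof. by rewrite dotxx => /eqP; rewrite expf_eq0 normr_eq0 => /eqP. Qed.

(** This reduces identities for an [H]-valued cocycle to identities for the scalar derivations
    obtained by pairing it with a vector. *)
Lemma dot_inj x y : (forall z, dot z x = dot z y) -> x = y.
Proof.
move=> h; apply/eqP; rewrite -subr_eq0; apply/eqP/dot_eq0.
by rewrite dotBr h subrr.
Qed.

End HilbertTheory.

(* The tuple (t, x, y, p) encodes the operator matrix
   [[t, <x|, p], [0, t id, |y>], [0, 0, t]] on C + H + C, with the involution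
   that combines the adjoint with the exchange of the two outer summands. *)
Definition gauss_alg (C : numClosedFieldType) (H : hilbertType C) : Type :=
  (C * H * H * C)%type.

(** * The star-algebra of operator matrices and its unitary exponentials *)

Section GaussAlgebra.
Variables (C : numClosedFieldType) (H : hilbertType C).
Local Notation G := (gauss_alg H).

HB.instance Definition _ := Choice.on G.
HB.instance Definition _ := GRing.Zmodule.copy G (C * H * H * C)%type.

Definition gscal (a : G) : C := a.1.1.1.
Definition gbra (a : G) : H := a.1.1.2.
Definition gket (a : G) : H := a.1.2.
Definition gcorner (a : G) : C := a.2.
Definition gmk (t : C) (x y : H) (p : C) : G := (t, x, y, p).

Lemma gaussP (a b : G) : gscal a = gscal b -> gbra a = gbra b ->
  gket a = gket b -> gcorner a = gcorner b -> a = b.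
Proof.
case: a b => [[[? ?] ?] ?] [[[? ?] ?] ?].
by rewrite /gscal /gbra /gket /gcorner /= => -> -> -> ->.
Qed.

Lemma gscalD (a b : G) : gscal (a + b) = gscal a + gscal b. Proof. by []. Qed.
Lemma gbraD (a b : G) : gbra (a + b) = gbra a + gbra b. Proof. by []. Qed.
Lemma gketD (a b : G) : gket (a + b) = gket a + gket b. Proof. by []. Qed.
Lemma gcornerD (a b : G) : gcorner (a + b) = gcorner a + gcorner b.
Proof. by []. Qed.

Definition gone : G := gmk 1 0 0 0.
(** A bra is stored as its vector, so scalars act on it through their conjugates. The corner entry
    has the shape of the identity for psi in a Schürmann triple. *)
Definition gmul (a b : G) : G := gmk (gscal a * gscal b)
  ((gscal a)^* *: gbra b + (gscal b)^* *: gbra a)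
  (gscal a *: gket b + gscal b *: gket a)
  (gscal a * gcorner b + gcorner a * gscal b + dot (gbra a) (gket b)).
Definition gscale (c : C) (a : G) : G :=
  gmk (c * gscal a) (c^* *: gbra a) (c *: gket a) (c * gcorner a).
Definition gstar (a : G) : G :=
  gmk (gscal a)^* (gket a) (gbra a) (gcorner a)^*.

Lemma gmkE (t : C) (x y : H) (p : C) :
  (gscal (gmk t x y p) = t) * (gbra (gmk t x y p) = x) *
  (gket (gmk t x y p) = y) * (gcorner (gmk t x y p) = p).
Proof. by []. Qed.

Let dotE :=
  (@dotDl C H, @dotDr C H, @dotZl C H, @dotZr C H, @dot0l C H, @dot0r C H).
Let gE := (gscalD, gbraD, gketD, gcornerD, gmkE).

Let gmulA : associative gmul.
Proof.
move=> a b c; apply: gaussP; rewrite /gmul !gE.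
- exact: mulrA.
- rewrite !rmorphM /= !scalerDr !scalerA -!addrA.
  by congr (_ + (_ *: _ + _ *: _)); rewrite mulrC.
- rewrite !scalerDr !scalerA -!addrA.
  by congr (_ + (_ *: _ + _ *: _)); rewrite mulrC.
- rewrite !dotE !conjCK; ring.
Qed.

Let gmul1 : left_id gone gmul.
Proof.
move=> a; apply: gaussP; rewrite /gmul /gone !gE ?conjC1.
- by rewrite mul1r.
- by rewrite scale1r scaler0 addr0.
- by rewrite scale1r scaler0 addr0.
- by rewrite dot0l mul1r mul0r !addr0.
Qed.

Let gmulr1 : right_id gone gmul.
Proof.
move=> a; apply: gaussP; rewrite /gmul /gone !gE ?conjC1.
- by rewrite mulr1.
- by rewrite scale1r scaler0 add0r.
- by rewrite scale1r scaler0 add0r.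
- by rewrite dot0r mulr1 mulr0 add0r addr0.
Qed.

Let gmulDl : left_distributive gmul +%R.
Proof.
move=> a b c; apply: gaussP; rewrite /gmul !gE ?rmorphD /=.
- by rewrite mulrDl.
- by rewrite scalerDl scalerDr addrACA.
- by rewrite scalerDl scalerDr addrACA.
- by rewrite dotDl; ring.
Qed.

Let gmulDr : right_distributive gmul +%R.
Proof.
move=> a b c; apply: gaussP; rewrite /gmul !gE ?rmorphD /=.
- by rewrite mulrDr.
- by rewrite scalerDl scalerDr addrACA.
- by rewrite scalerDl scalerDr addrACA.
- by rewrite dotDr; ring.
Qed.

Let gone_neq0 : gone != 0.
Proof. by apply/eqP => /(congr1 gscal)/eqP; rewrite oner_eq0. Qed.

HB.instance Definition _ := GRing.Zmodule_isNzRing.Build G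
  gmulA gmul1 gmulr1 gmulDl gmulDr gone_neq0.

Let gscaleA c c' (a : G) : gscale c (gscale c' a) = gscale (c * c') a.
Proof.
by apply: gaussP; rewrite /gscale !gE ?rmorphM /= ?scalerA ?mulrA.
Qed.

Let gscale1 : left_id 1 gscale.
Proof.
by move=> a; apply: gaussP; rewrite /gscale !gE ?conjC1 ?mul1r ?scale1r.
Qed.

Let gscaleDr : right_distributive gscale +%R.
Proof.
by move=> c a b; apply: gaussP; rewrite /gscale !gE ?mulrDr ?scalerDr.
Qed.

Let gscaleDl a : {morph gscale^~ a : c c' / c + c' >-> c + c'}.
Proof.
move=> c c'; apply: gaussP; rewrite /gscale !gE ?rmorphD /=;
  by rewrite ?mulrDl ?scalerDl.
Qed.

HB.instance Definition _ := GRing.Zmodule_isLmodule.Build C G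
  gscaleA gscale1 gscaleDr gscaleDl.

Let gscaleAl (c : C) (a b : G) : c *: (a * b) = (c *: a) * b.
Proof.
change (gscale c (gmul a b) = gmul (gscale c a) b).
apply: gaussP; rewrite /gscale /gmul !gE ?dotZl ?conjCK ?rmorphM /=.
- by rewrite mulrA.
- by rewrite scalerDr !scalerA [_^* * (gscal b)^*]mulrC.
- by rewrite scalerDr !scalerA [c * gscal b]mulrC.
- by ring.
Qed.
HB.instance Definition _ := GRing.Lmodule_isLalgebra.Build C G gscaleAl.

Let gscaleAr (c : C) (a b : G) : c *: (a * b) = a * (c *: b).
Proof.
change (gscale c (gmul a b) = gmul a (gscale c b)).
apply: gaussP; rewrite /gscale /gmul !gE ?dotZr ?rmorphM /=.
- by rewrite mulrCA.
- by rewrite scalerDr !scalerA [_^* * (gscal a)^*]mulrC.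
- by rewrite scalerDr !scalerA [c * gscal a]mulrC.
- by ring.
Qed.
HB.instance Definition _ := GRing.Lalgebra_isAlgebra.Build C G gscaleAr.

Let gstarK : involutive gstar.
Proof. by move=> a; apply: gaussP; rewrite /gstar !gE ?conjCK. Qed.
Let gstarD (a b : G) : gstar (a + b) = gstar a + gstar b.
Proof. by apply: gaussP; rewrite /gstar !gE ?rmorphD. Qed.
Let gstarZ (c : C) (a : G) : gstar (c *: a) = c^* *: gstar a.
Proof.
change (gstar (gscale c a) = gscale c^* (gstar a)).
by apply: gaussP; rewrite /gstar /gscale !gE ?rmorphM ?conjCK.
Qed.
Let gstarM (a b : G) : gstar (a * b) = gstar b * gstar a.
Proof.
change (gstar (gmul a b) = gmul (gstar b) (gstar a)).
apply: gaussP; rewrite /gstar /gmul !gE ?rmorphD ?rmorphM ?conjCK /=.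
- by rewrite mulrC.
- by rewrite addrC.
- by rewrite addrC.
- by rewrite -dot_conj; ring.
Qed.
HB.instance Definition _ := Algebra_hasStar.Build C G gstarK gstarD gstarZ gstarM.

Lemma gaussM (a b : G) : a * b = gmul a b. Proof. by []. Qed.
Lemma gaussZ c (a : G) : c *: a = gscale c a. Proof. by []. Qed.
Lemma gauss1 : (1 : G) = gone. Proof. by []. Qed.
Lemma gauss_star (a : G) : star a = gstar a. Proof. by []. Qed.

(* The exponential of the skew element (0, -h, h, 0). *)
Definition gexp (h : H) : G := gmk 1 (- h) h (- (dot h h / 2)).

Lemma conj_dotxx (h : H) : (dot h h)^* = dot h h.
Proof. by rewrite -dot_conj. Qed.

Let conj_half (h : H) : (- (dot h h / 2))^* = - (dot h h / 2).
Proof. by rewrite rmorphN rmorphM /= conj_dotxx fmorphV /= conjC_nat. Qed.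

Lemma gexp_star (h : H) : star (gexp h) = gexp (- h).
Proof.
apply: gaussP; rewrite gauss_star /gstar /gexp !gE ?conjC1 ?opprK //.
by rewrite dotNl dotNr opprK.
Qed.

(** The two corners, each minus half of [dot h h], cancel the pairing of the bra [- h] with the ket
    [- h]. Together with [gexp_star] this makes [gexp h] unitary. *)
Lemma gexpV (h : H) : gexp h * gexp (- h) = 1.
Proof.
apply: gaussP; rewrite gaussM gauss1 /gone /gmul /gexp !gE ?conjC1.
- by rewrite mulr1.
- by rewrite !scale1r opprK subrr.
- by rewrite !scale1r addNr.
- by rewrite !dotNl !dotNr !opprK; field.
Qed.

Lemma gket_sum (I : Type) (r : seq I) (P : pred I) (f : I -> G) :
  gket (\sum_(i <- r | P i) f i) = \sum_(i <- r | P i) gket (f i).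
Proof. by apply: (big_morph gket). Qed.

Lemma gbra_sum (I : Type) (r : seq I) (P : pred I) (f : I -> G) :
  gbra (\sum_(i <- r | P i) f i) = \sum_(i <- r | P i) gbra (f i).
Proof. by apply: (big_morph gbra). Qed.

Lemma gscal_sum (I : Type) (r : seq I) (P : pred I) (f : I -> G) :
  gscal (\sum_(i <- r | P i) f i) = \sum_(i <- r | P i) gscal (f i).
Proof. by apply: (big_morph gscal). Qed.

End GaussAlgebra.

(** * Scalar derivations at a character and the defining relations *)

Section Derivation.
Variables (C : numClosedFieldType) (A : starAlgType C) (eps f : A -> C).
Hypotheses (heps : character eps) (f_lin : scalar f).
Hypothesis f_der : forall a b, f (a * b) = eps a * f b + eps b * f a.
Variable d : nat.
Implicit Types (X Y : 'M[A]_d) (M : 'M[C]_d).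

Lemma scalar_add (g : A -> C) : scalar g -> {morph g : a b / a + b}.
Proof. by move=> gL a b; rewrite -[a]scale1r gL mul1r scale1r. Qed.

Lemma scalar_0 (g : A -> C) : scalar g -> g 0 = 0.
Proof. by move=> gL; apply: (addrI (g 0)); rewrite -scalar_add // !addr0. Qed.

Lemma scalar_scale (g : A -> C) c a : scalar g -> g (c *: a) = c * g a.
Proof. by move=> gL; rewrite -[c *: a]addr0 gL scalar_0 // addr0. Qed.

Lemma derivation1 : f 1 = 0.
Proof.
case: heps => _ e1 _ _; have := f_der 1 1.
by rewrite mulr1 e1 !mul1r -{1}[f 1]addr0 => /addrI <-.
Qed.

Lemma map_eps_mxM X Y :
  map_mx eps (X *m Y) = map_mx eps X *m map_mx eps Y.
Proof.
case: heps => eL e1 eM eS; apply/matrixP => i j; rewrite !mxE.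
rewrite (big_morph eps (scalar_add eL) (scalar_0 eL)).
by apply: eq_bigr => k _; rewrite eM !mxE.
Qed.

Lemma map_derivation_mxM X Y : map_mx f (X *m Y) =
  map_mx eps X *m map_mx f Y + map_mx f X *m map_mx eps Y.
Proof.
apply/matrixP => i j; rewrite !mxE.
rewrite (big_morph f (scalar_add f_lin) (scalar_0 f_lin)) -big_split /=.
by apply: eq_bigr => k _; rewrite f_der !mxE [eps (Y _ _) * _]mulrC.
Qed.

Lemma map_eps_alg_mx M : map_mx eps (alg_mx A M) = M.
Proof.
case: heps => eL e1 _ _; apply/matrixP => i j.
by rewrite !mxE scalar_scale // e1 mulr1.
Qed.

Lemma map_derivation_alg_mx M : map_mx f (alg_mx A M) = 0.
Proof.
by apply/matrixP => i j; rewrite !mxE scalar_scale // derivation1 mulr0.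
Qed.

Lemma map_derivation_mx1 : map_mx f (1%:M : 'M[A]_d) = 0.
Proof. by rewrite -alg_mx1 map_derivation_alg_mx. Qed.

Variables (F : 'M[C]_d) (u : 'M[A]_d).
Hypotheses (hF : F \in unitmx) (hu : PolU_relations F u).
Hypothesis eps_u : map_mx eps u = 1%:M.

Lemma map_eps_bar_mx : map_mx eps (bar_mx u) = 1%:M.
Proof.
case: heps => _ _ _ eS; apply/matrixP => i j.
have /matrixP/(_ i j) := eps_u; rewrite !mxE eS => ->.
by case: eqP => _; rewrite ?conjC1 ?conjC0.
Qed.

(** Differentiate [u *m adj_mx u = 1%:M]: [eps] sends both factors to the identity, so the Leibniz
    rule leaves the sum of the two derivatives. *)
Lemma map_derivation_adj_mx : map_mx f (adj_mx u) = - map_mx f u.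
Proof.
have [[uu _] _] := hu; have := congr1 (map_mx f) uu.
have eps_adj : map_mx eps (adj_mx u) = 1%:M.
  by rewrite -map_trmx map_eps_bar_mx trmx1.
rewrite map_derivation_mxM eps_u eps_adj map_derivation_mx1 mul1mx mulmx1 => /eqP.
by rewrite addr_eq0 => /eqP.
Qed.

(** Write z for the transpose of f(u). Then f maps the entrywise conjugate of u to -z, its adjoint
    to z, and scalar matrices to 0. Differentiating the unitarity of F times this conjugate times
    F^-1 gives [GV z G = F z F^-1], with [G = ctrmx F] and [GV] its inverse; multiply by [G] on the
    left and [F] on the right. *)
Lemma derivation_commute :
  (map_mx f u)^T *m (ctrmx F *m F) = (ctrmx F *m F) *m (map_mx f u)^T.
Proof.
have [_ [vv _]] := hu; set z := (map_mx f u)^T.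
have fbar : map_mx f (bar_mx u) = - z.
  rewrite -[bar_mx u]trmxK -map_trmx -/(adj_mx u) map_derivation_adj_mx.
  by rewrite linearN.
have := congr1 (map_mx f) vv.
rewrite !adj_mxM !adj_alg_mx map_derivation_mx1.
have adjbar : adj_mx (bar_mx u) = u^T.
  by apply/matrixP => i j; rewrite !mxE starK.
rewrite adjbar !(map_derivation_mxM, map_eps_mxM, map_derivation_alg_mx).
rewrite !map_eps_alg_mx map_eps_bar_mx fbar -!map_trmx eps_u -/z trmx1.
rewrite !(mulmx0, mul0mx, mulmx1, addr0, add0r) mulmxV // mul1mx.
set G := ctrmx F; set GV := ctrmx (invmx F).
have GGV : G *m GV = 1%:M by rewrite -ctrmxM mulVmx // ctrmx1.
have GVG : GV *m G = 1%:M by rewrite -ctrmxM mulmxV // ctrmx1.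
rewrite GVG mulmx1 mulmxN mulNmx => /eqP; rewrite subr_eq0 mul1mx => /eqP h.
have := congr1 (fun X : 'M[C]_d => G *m X *m F) h.
rewrite /= !mulmxA GGV mul1mx => ->.
by rewrite -!mulmxA mulVmx // mulmx1.
Qed.

End Derivation.

(** * Completion of Gaussian cocycles on Pol(U_F^+) *)

Section GaussianCocycle.
Variables (C : numClosedFieldType) (d : nat) (F : 'M[C]_d) (hF : F \in unitmx).
Variables (H : hilbertType C) (eta : PolU hF -> H).
Hypothesis heta : gaussian_cocycle (counit hF) eta.
Local Notation u := (PolU_gen hF).
Local Notation eps := (counit hF).

Let fdot (x : H) (a : PolU hF) : C := dot x (eta a).

Let fdot_lin x : scalar (fdot x).
Proof. by move=> c a b; rewrite /fdot (cocycle_linear heta) dotDr dotZr. Qed.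

Let fdot_der x a b : fdot x (a * b) = eps a * fdot x b + eps b * fdot x a.
Proof. by rewrite /fdot (cocycleM heta) dotDr !dotZr. Qed.

Let eps_u : map_mx eps u = 1%:M.
Proof. by apply/matrixP => i j; rewrite [LHS]mxE counit_gen mxE. Qed.

Lemma gaussian_cocycle_star_gen k j : eta (star (u k j)) = - eta (u j k).
Proof.
apply: dot_inj => x; rewrite dotNr.
have /matrixP/(_ j k) := map_derivation_adj_mx (counit_character hF)
  (fdot_lin x) (fdot_der x) (PolU_gen_relations hF) eps_u.
rewrite [LHS]mxE [X in fdot x X]mxE [X in fdot x X]mxE.
by rewrite [RHS]mxE [X in - X]mxE.
Qed.

(** After pairing with any [x], the scalar matrix [z] commutes with Q, so [y = U z U^*] commutes
    with [diag_mx D] and is diagonal. Expanding [z = U^* y U] leaves a single sum. *)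
Lemma gaussian_cocycle_gen (U : 'M[C]_d) (D : 'rV[C]_d) :
  U *m ctrmx U = 1%:M -> ctrmx F *m F = ctrmx U *m diag_mx D *m U ->
  injective (D 0) ->
  exists h : 'I_d -> H,
    forall k j, eta (u k j) = \sum_i (U i k * (U i j)^*) *: h i.
Proof.
move=> UV QE Dinj; have VU := mulmx1C UV.
(* This is the [i]-th diagonal entry of U Z U^*, where Z has the vector [eta (u b a)] in position
   [(a, b)]. *)
exists (fun i => \sum_a \sum_b (U i a * (U i b)^*) *: eta (u b a)) => k j.
apply: dot_inj => x; rewrite dot_sumr.
set z := (map_mx (fdot x) u)^T.
have zQ : z *m (ctrmx F *m F) = (ctrmx F *m F) *m z.
  exact: (derivation_commute (counit_character hF) (fdot_lin x) (fdot_der x)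
           hF (PolU_gen_relations hF) eps_u).
set Q := ctrmx F *m F in QE zQ; clearbody Q.
pose y := U *m z *m ctrmx U.
have yD : y *m diag_mx D = diag_mx D *m y.
  have -> : diag_mx D = U *m Q *m ctrmx U.
    by rewrite QE !mulmxA UV mul1mx -mulmxA UV mulmx1.
  rewrite /y -!mulmxA !(mulmxA (ctrmx U) U) VU !mul1mx.
  by congr (_ *m _); rewrite !mulmxA zQ.
have yE := commute_diag_mx Dinj yD.
have zE a b : z a b = dot x (eta (u b a)) by rewrite [LHS]mxE [LHS]mxE.
have ctE a b : ctrmx U a b = (U b a)^* by rewrite [LHS]mxE [LHS]mxE.
have -> : dot x (eta (u k j)) = (ctrmx U *m y *m U) j k.
  by rewrite -zE /y !mulmxA VU mul1mx -mulmxA VU mulmx1.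
rewrite mxE; apply: eq_bigr => i _.
rewrite mxE (bigD1 i) //= big1 ?addr0; last by move=> l li; rewrite yE ?mulr0.
rewrite dotZr ctE mulrAC [_^* * _]mulrC; congr (_ * _).
rewrite dot_sumr mxE.
under eq_bigr => b _ do rewrite mxE big_distrl.
rewrite exchange_big /=; apply: eq_bigr => a _.
rewrite dot_sumr; apply: eq_bigr => b _.
by rewrite dotZr zE ctE mulrAC.
Qed.

Hypothesis hgen : generic_mx F.

Lemma gaussian_cocycle_lift : exists phi : PolU hF -> gauss_alg H,
  star_morphism phi /\
  forall a, gscal (phi a) = eps a /\ gket (phi a) = eta a.
Proof.
have [U [D [UV VU QE Dinj]]] := generic_spectral hgen.
have [h hE] := gaussian_cocycle_gen UV QE Dinj.
pose b : 'rV[gauss_alg H]_d := \row_i gexp (h i).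
pose v := alg_mx (gauss_alg H) U^T *m diag_mx b *m alg_mx _ (map_mx Num.conj U).
have hv : PolU_relations F v.
  apply: diagonal_PolU_relations QE _ _ => // i; rewrite !mxE gexp_star.
  - exact: gexpV.
  - by rewrite -{2}[h i]opprK gexpV.
have vE k j : v k j = \sum_i (U i k * (U i j)^*) *: gexp (h i).
  by rewrite alg_diag_algE; apply: eq_bigr => i _; rewrite !mxE.
pose phi : PolU hF -> gauss_alg H := PolU_lift v.
have [phiL phi1 phiM phiS] := PolU_lift_morphism hF hv.
rewrite -/phi in phiL phi1 phiM phiS.
exists phi; split=> // a.
(* The induction has to carry the bra as well, since [star] exchanges it with the ket. *)
suff [-> -> _] : [/\ gscal (phi a) = eps a,
    gket (phi a) = eta a & gbra (phi a) = eta (star a)] by [].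
have [eL e1 eM eS] := counit_character hF.
have etaD := cocycle_linear heta.
have eta_add p q : eta (p + q) = eta p + eta q.
  by rewrite -[p]scale1r etaD !scale1r.
have eta0 : eta 0 = 0 by apply: (addrI (eta 0)); rewrite -eta_add !addr0.
have eta1 : eta 1 = 0.
  have := cocycleM heta 1 1; rewrite /eps_rep mulr1 e1 scale1r.
  by rewrite -{1}[eta 1]addr0 => /addrI <-.
have etaC c : eta c%:A = 0 by rewrite -[c%:A]addr0 etaD eta1 eta0 addr0 scaler0.
have phi_add p q : phi (p + q) = phi p + phi q.
  by rewrite -[p]scale1r phiL !scale1r.
have phi0 : phi 0 = 0.
  by apply: (addrI (phi 0)); rewrite -phi_add !addr0.
have phiC c : phi c%:A = c%:A by rewrite -[c%:A]addr0 phiL phi1 phi0 addr0.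
elim/PolU_ind: a => [k j|c|p q [IHp1 IHp2 IHp3] [IHq1 IHq2 IHq3]
    |p q [IHp1 IHp2 IHp3] [IHq1 IHq2 IHq3]|p [IHp1 IHp2 IHp3]].
- rewrite /phi PolU_lift_gen // vE counit_gen gaussian_cocycle_star_gen !hE.
  rewrite gscal_sum gket_sum gbra_sum; split=> //.
  + have /matrixP/(_ j k) := VU; rewrite !mxE eq_sym => <-.
    by apply: eq_bigr => i _; rewrite !mxE gaussZ /= /gscal /= mulr1 mulrC.
  + rewrite -sumrN; apply: eq_bigr => i _.
    by rewrite gaussZ /gbra /= scalerN rmorphM /= conjCK mulrC.
- rewrite phiC etaC star_alg etaC gaussZ gauss1 /gscale /gone.
  rewrite /gscal /gket /gbra /= !scaler0 mulr1; split=> //.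
  by rewrite scalar_scale // e1 mulr1.
- rewrite phi_add starD !eta_add gscalD gketD gbraD.
  rewrite IHp1 IHp2 IHp3 IHq1 IHq2 IHq3.
  by rewrite (scalar_add eL).
- rewrite phiM gaussM starM !(cocycleM heta) eM /gmul !gmkE.
  rewrite IHp1 IHp2 IHp3 IHq1 IHq2 IHq3 /eps_rep !eS; split=> //.
  by rewrite addrC.
- by rewrite phiS gauss_star /gstar !gmkE IHp1 IHp2 IHp3 eS starK.
Qed.

Lemma setT_closed_subspace : closed_subspace (setT : set H).
Proof. by split=> //; exact: closedT. Qed.

Lemma eps_rep_representation : representation setT (@eps_rep _ _ eps H).
Proof.
have [eL e1 eM eS] := counit_character hF.
split.
- exact: setT_closed_subspace.
- move=> a; split=> //.
  + by move=> c x y _ _; rewrite /eps_rep scalerDr !scalerA mulrC.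
  + by exists `|eps a| => x _; rewrite /eps_rep normrZ.
- by move=> c a b x _; rewrite /eps_rep eL scalerDl scalerA.
- by move=> x _; rewrite /eps_rep e1 scale1r.
- by move=> a b x _; rewrite /eps_rep eM scalerA.
- by move=> a x y _ _; rewrite /eps_rep eS dotZl dotZr conjCK.
Qed.

(** Take the corner of the lift: the corner of a product is the required identity, because the bra
    of [phi a] is the ket of [phi (star a)], that is [eta (star a)]. The hermitian symmetry is
    recorded for use in (LK). *)
Lemma gaussian_cocycle_completion : exists psi : PolU hF -> C,
  schurmann_triple eps setT (@eps_rep _ _ eps H) eta psi /\
  forall a, psi (star a) = (psi a)^*.
Proof.
have [phi [[phiL phi1 phiM phiS] phiE]] := gaussian_cocycle_lift.
exists (fun a => gcorner (phi a)); split; last by move=> a; rewrite phiS.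
split=> //.
- exact: eps_rep_representation.
- by move=> c a b; rewrite phiL.
- move=> a b; rewrite phiM gaussM /gmul gmkE.
  have [-> _] := phiE a; have [-> ->] := phiE b.
  have [_ <-] := phiE (star a); rewrite phiS gauss_star gmkE.
  by rewrite [eps a * _ + _]addrC.
Qed.

End GaussianCocycle.

(** * Closest points in closed subspaces *)

Section Projection.
Variables (R : realType) (H : hilbertType R[i]).
Implicit Types (x y z w : H) (V : set H).

(** The norm has values in [R[i]]; its real part gives access to infima, square roots and real
    arithmetic. *)
Definition rnorm x : R := complex.Re `|x|.

Lemma rnormE x : ((rnorm x)%:C)%C = `|x|.
Proof. rewrite /rnorm RRe_real //; exact: normr_real. Qed.

Lemma rnorm_ge0 x : 0 <= rnorm x.
Proof. rewrite -lecR rnormE; exact: normr_ge0. Qed.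

Lemma ler_rnormD x y : rnorm (x + y) <= rnorm x + rnorm y.
Proof. rewrite -lecR rmorphD /= !rnormE; exact: ler_normD. Qed.

Lemma rnorm_sqr x : ((rnorm x ^+ 2)%:C)%C = dot x x.
Proof. by rewrite rmorphXn /= rnormE dotxx. Qed.

Lemma rnorm_parallelogram x y :
  rnorm (x - y) ^+ 2 + rnorm (x + y) ^+ 2 = 2 * rnorm x ^+ 2 + 2 * rnorm y ^+ 2.
Proof.
rewrite !mulr_natl; apply: complexI.
rewrite [LHS]rmorphD [RHS]rmorphD !rmorphMn /= !rnorm_sqr.
rewrite !(dotDl, dotDr, dotNl, dotNr); ring.
Qed.

Lemma rnormZ_nat n x : rnorm (n%:R *: x) = n%:R * rnorm x.
Proof.
by apply: complexI; rewrite rmorphM /= rmorph_nat !rnormE normrZ normr_nat.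
Qed.

Lemma closed_approx V :
  (forall x,
    (forall e : R, 0 < e -> exists2 y, V y & rnorm (x - y) < e) -> V x) ->
  closed V.
Proof.
move=> h x Vx; apply: h => e e0.
have [|y [Vy]] := Vx (ball x (e%:C)%C).
  by apply: nbhsx_ballx; rewrite ltcR.
by rewrite -ball_normE /= -rnormE ltcR => ?; exists y.
Qed.

Lemma closed_subspaceD V x y : closed_subspace V -> V x -> V y -> V (x + y).
Proof. by case=> _ h _ Vx Vy; rewrite -[x]scale1r; apply: h. Qed.

Lemma closed_subspaceZ V c x : closed_subspace V -> V x -> V (c *: x).
Proof. by case=> V0 h _ Vx; rewrite -[_ *: _]addr0; apply: h. Qed.

Lemma closed_subspaceB V x y : closed_subspace V -> V x -> V y -> V (x - y).
Proof.
move=> hV Vx Vy; rewrite -scaleN1r.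
by apply: closed_subspaceD => //; exact: closed_subspaceZ.
Qed.

(** The sets of near-minimizers of the distance to [x] generate a Cauchy filter. Its limit exists by
    completeness, lies in [V] by closedness and attains the infimum. *)
Lemma closest_point V x : closed_subspace V ->
  exists2 y, V y & forall z, V z -> rnorm (x - y) <= rnorm (x - z).
Proof.
move=> hV; have [V0 _ Vcl] := hV.
pose S := [set rnorm (x - y) | y in V].
have Slb : lbound S 0 by move=> _ [y _ <-]; exact: rnorm_ge0.
have S0 : S !=set0 by exists (rnorm (x - 0)), 0.
have infS : has_inf S by split=> //; exists 0.
set d := inf S.
have d_ge0 : 0 <= d by exact: lb_le_inf.
have d_le z : V z -> d <= rnorm (x - z).
  by move=> Vz; apply: ge_inf; [exists 0 | exists z].
pose ball_V (e : R) := [set y | V y /\ rnorm (x - y) < d + e].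
have ball_V0 e : 0 < e -> ball_V e !=set0.
  by move=> e0; have [_ [y Vy <-] ye] := inf_adherent e0 infS; exists y.
pose Fl := filter_from [set e : R | 0 < e] ball_V.
have FlF : ProperFilter Fl.
  apply: filter_from_proper => [|e]; last exact: ball_V0.
  apply: filter_from_filter; first by exists 1; exact: ltr01.
  move=> e f e0 f0; exists (Num.min e f); first by rewrite /= lt_min e0 f0.
  move=> y [Vy ye]; split; split=> //; apply: lt_le_trans ye _;
    by rewrite lerD2l ge_min lexx ?orbT.
(* By the parallelogram law, two points of V at distance less than d + e
   from x have distance at most 2 sqrt ((d + e)^2 - d^2). *)
have dist_V e y z : ball_V e y -> ball_V e z ->
    rnorm (y - z) ^+ 2 <= 4 * ((d + e) ^+ 2 - d ^+ 2).
  move=> [Vy ye] [Vz ze].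
  have := rnorm_parallelogram (x - z) (x - y).
  have -> : x - z - (x - y) = y - z by rewrite opprB addrC addrA subrK.
  (* The midpoint lies in [V], so its distance from [x] is at least [d], which bounds the second
     term of the parallelogram law below by [4 * d ^+ 2]. *)
  pose m := 2^-1 *: (y + z).
  have -> : x - z + (x - y) = 2%:R *: (x - m).
    rewrite scalerBr scalerA mulfV ?pnatr_eq0 // scale1r scaler_nat mulr2n.
    by rewrite addrACA opprD [- z - y]addrC.
  rewrite rnormZ_nat.
  have dm : d <= rnorm (x - m).
    by apply: d_le; apply: closed_subspaceZ => //; exact: closed_subspaceD.
  have := rnorm_ge0 (x - y); have := rnorm_ge0 (x - z).
  by nra.
have cauchyFl : cauchy Fl.
  apply: cauchy_exP => eps eps0.
  have epsE : eps = ((complex.Re eps)%:C)%C by rewrite RRe_real // gtr0_real.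
  set r := complex.Re eps in epsE.
  have r0 : 0 < r by rewrite -ltcR -epsE.
  (* Chosen so that the bound of [dist_V] becomes [r ^+ 2 / 2], which is less than [r ^+ 2]. *)
  pose e := Num.sqrt (d ^+ 2 + r ^+ 2 / 8) - d.
  have sqr_e : (d + e) ^+ 2 = d ^+ 2 + r ^+ 2 / 8.
    by rewrite /e addrC subrK sqr_sqrtr //; nra.
  have e0 : 0 < e.
    rewrite subr_gt0 -[ltLHS]ger0_norm // -sqrtr_sqr ltr_sqrt; nra.
  have [y Vy] := ball_V0 e e0.
  exists y, e => // z Vz; rewrite -ball_normE /= epsE -rnormE ltcR.
  rewrite -(ltr_pXn2r (n := 2)) ?nnegrE ?rnorm_ge0 ?(ltW r0) //.
  by apply: le_lt_trans (dist_V _ _ _ Vy Vz) _; rewrite sqr_e; nra.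
have /cvg_ex[y Fly] := @cauchy_cvg H Fl FlF cauchyFl.
have nearV e : 0 < e -> exists2 z, ball_V e z & rnorm (y - z) < e.
  move=> e0.
  have : Fl (ball y (e%:C)%C `&` ball_V e).
    apply: filterI; last by exists e.
    by apply: Fly; apply: nbhsx_ballx; rewrite ltcR.
  move=> /filter_ex[z [+ zV]].
  by rewrite -ball_normE /= -rnormE ltcR => ?; exists z.
exists y.
  apply: Vcl => B /nbhs_ballP[eps eps0 epsB].
  have epsE : eps = ((complex.Re eps)%:C)%C by rewrite RRe_real // gtr0_real.
  have r0 : 0 < complex.Re eps by rewrite -ltcR -epsE.
  have [z [Vz _] zy] := nearV _ r0; exists z; split=> //.
  by apply: epsB; rewrite -ball_normE /= epsE -rnormE ltcR.
move=> z Vz; apply: le_trans (d_le z Vz); apply/ler_addgt0Pr => e e0.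
have [w [_ xw] yw] := nearV (e / 2) (divr_gt0 e0 (ltr0n _ 2)).
have := ler_rnormD (x - w) (w - y); rewrite addrA subrK.
have -> : rnorm (w - y) = rnorm (y - w) by rewrite /rnorm distrC.
by lra.
Qed.

(** If the residual [a] of the closest point had a nonzero product [c] with some [w] in [V], moving
    the point by a small multiple of [c *: w] would bring it closer to [x]. *)
Lemma orthoproj_exists V x : closed_subspace V ->
  exists y, V y /\ orthocomplement V (x - y).
Proof.
move=> hV; have [y Vy ymin] := closest_point x hV.
exists y; split=> // w Vw; apply/eqP; apply: contraT => c_neq0.
set a := x - y in c_neq0; set c := dot w a in c_neq0.
(* The squared norm drops by t |c|^2 (2 - t |w|^2). The summand 1 keeps the denominator positive and
   makes t |w|^2 less than 1. *)
pose t : R[i] := (1 + `|w| ^+ 2)^-1.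
have w0 : 0 <= `|w| ^+ 2 :> R[i] by rewrite exprn_ge0.
have t0 : 0 < t by rewrite invr_gt0 ltr_wpDr.
have tconj : t^* = t by apply/CrealP; rewrite gtr0_real.
have cc : 0 < c * c^* by rewrite mul_conjC_gt0.
have : `|a| ^+ 2 <= `|a - (t * c) *: w| ^+ 2 :> R[i].
  rewrite lerXn2r ?nnegrE // -!rnormE lecR /a -addrA -opprD.
  by apply: ymin; apply: closed_subspaceD => //; exact: closed_subspaceZ.
clearbody a; rewrite -!dotxx !(dotDl, dotDr, dotNl, dotNr, dotZl, dotZr) -/c.
have -> : dot a w = c^* by rewrite -dot_conj.
rewrite rmorphM /= tconj dotxx [dot w w]dotxx.
set s := (X in _ <= X).
have -> : s =
    `|a| ^+ 2 - t * (c * c^*) * (2 - t * `|w| ^+ 2) by rewrite /s; ring.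
rewrite lerDl oppr_ge0 pmulr_rle0; last exact: mulr_gt0.
rewrite subr_le0 => h.
have : t * `|w| ^+ 2 < 1.
  by rewrite /t mulrC ltr_pdivrMr ?mul1r ?ltrDr // ltr_wpDr.
by move=> /(le_lt_trans h); rewrite (ltr_nat _ 2 1).
Qed.

End Projection.

(** * Orthogonal projections and orthocomplements *)

Section OrthogonalProjection.
Variables (R : realType) (H : hilbertType R[i]).
Implicit Types (x y z w : H) (V : set H).

Lemma rnorm_eq0 x : rnorm x = 0 -> x = 0.
Proof. by move=> x0; apply: dot_eq0; rewrite -rnorm_sqr x0 expr0n. Qed.

Lemma orthoprojP V x : closed_subspace V ->
  V (orthoproj V x) /\ orthocomplement V (x - orthoproj V x).
Proof. by move=> hV; have /(xgetPex 0) := orthoproj_exists x hV. Qed.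

Lemma orthoproj_uniq V x y : closed_subspace V ->
  V y -> orthocomplement V (x - y) -> orthoproj V x = y.
Proof.
move=> hV Vy xy; have [Vp xp] := orthoprojP x hV.
apply/eqP; rewrite -subr_eq0; apply/eqP/dot_eq0.
set p := orthoproj V x in Vp xp *.
have Vpy : V (p - y) by exact: closed_subspaceB.
have := xy _ Vpy; have := xp _ Vpy; rewrite !dotBr => h1 h2.
by rewrite -[RHS]h2 -[RHS]subr0 -h1; ring.
Qed.

Lemma orthoproj_linear V : closed_subspace V -> linear (orthoproj V).
Proof.
move=> hV c x y; have [Vx xV] := orthoprojP x hV; have [Vy yV] := orthoprojP y hV.
apply: orthoproj_uniq => //; first by case: hV => _ h _; exact: h.
move=> z Vz; rewrite opprD addrACA -scalerBr dotDr dotZr xV // yV //.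
by rewrite mulr0 addr0.
Qed.

(** For closedness, let [p] be the projection of [x] on [V]. For [z] orthogonal to [V], Pythagoras
    applied to [x - z = p + (x - p - z)] bounds the norm of [p] by that of [x - z]; approximating
    [x] by such [z] forces [p = 0]. *)
Lemma orthocomplement_closed_subspace V :
  closed_subspace V -> closed_subspace (orthocomplement V).
Proof.
move=> hV; split=> [y _|c x y xV yV z Vz|]; first exact: dot0r.
  by rewrite dotDr dotZr xV // yV // mulr0 addr0.
apply: closed_approx => x happ.
have [Vp xp] := orthoprojP x hV; set p := orthoproj V x in Vp xp.
suff p0 : p = 0 by rewrite p0 subr0 in xp.
apply: rnorm_eq0; apply/eqP; rewrite eq_le rnorm_ge0 andbT leNgt.
apply/negP => /happ[z zV]; apply/negP; rewrite -leNgt.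
rewrite -(ler_pXn2r (n := 2)) ?nnegrE ?rnorm_ge0 //.
have pq : dot p (x - p - z) = 0 by rewrite dotBr xp // zV // subr0.
have qp : dot (x - p - z) p = 0 by rewrite dot_conj pq conjC0.
have -> : x - z = p + (x - p - z) by rewrite addrA [p + _]addrC subrK.
set q := x - p - z in pq qp *; clearbody q.
rewrite -lecR !rnorm_sqr dotDl !dotDr pq qp addr0 add0r lerDl -rnorm_sqr.
by rewrite (lecR 0) sqr_ge0.
Qed.

End OrthogonalProjection.

(** * The Gaussian subspace of a representation *)

Section GaussianSpace.
Variables (R : realType) (A : starAlgType R[i]) (eps : A -> R[i]).
Variables (H : hilbertType R[i]) (rho : A -> H -> H).
Hypothesis hrho : representation setT rho.

Lemma rep_add a x y : rho a (x + y) = rho a x + rho a y.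
Proof.
have [_ h _] := rep_bounded hrho a.
by rewrite -[x in LHS]scale1r h // scale1r.
Qed.

Lemma rep_scale a (c : R[i]) x : rho a (c *: x) = c *: rho a x.
Proof.
have [_ h _] := rep_bounded hrho a.
have r0 : rho a 0 = 0 by apply: (addrI (rho a 0)); rewrite -rep_add !addr0.
by rewrite -[c *: x]addr0 h // r0 addr0.
Qed.

Lemma rep_sub a x y : rho a (x - y) = rho a x - rho a y.
Proof. by rewrite rep_add -scaleN1r rep_scale scaleN1r. Qed.

Lemma gaussian_space_closed_subspace : closed_subspace (gaussian_space eps rho).
Proof.
split=> [a|c x y xG yG a|].
- by rewrite scaler0 -(scale0r (0 : H)) rep_scale !scale0r.
- by rewrite rep_add rep_scale xG yG scalerDr !scalerA mulrC.
apply: closed_approx => x happ a; apply/eqP; rewrite -subr_eq0; apply/eqP.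
set w := _ - _; have [_ _ [M hM]] := rep_bounded hrho a.
(* The bound [M] is an arbitrary element of [R[i]]; its modulus is a nonnegative bound. As
   [rho a - eps a] vanishes on Gaussian vectors, [w] is its value at [x - y] for every Gaussian [y],
   which gives the estimate [hw]. *)
have hM' y : `|rho a y| <= `|M| * `|y|.
  have := hM y I => h; rewrite -[`|y|]normr_id -normrM.
  apply: le_trans h _; apply: real_ler_norm; apply: ger0_real.
  exact: le_trans (hM y I).
pose k := complex.Re (`|M| + `|eps a|).
have kE : ((k%:C)%C) = `|M| + `|eps a|.
  by rewrite RRe_real // ger0_real // addr_ge0.
have k0 : 0 <= k by rewrite -lecR kE addr_ge0.
have hw y : gaussian_space eps rho y -> rnorm w <= k * rnorm (x - y).
  move=> yG; rewrite -lecR rmorphM /= kE !rnormE.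
  have -> : w = rho a (x - y) - eps a *: (x - y).
    by rewrite rep_sub yG scalerBr opprB addrA subrK.
  apply: le_trans (ler_normB _ _) _.
  by rewrite mulrDl normrZ lerD.
apply: rnorm_eq0; apply/eqP; rewrite eq_le rnorm_ge0 andbT leNgt.
apply/negP => w0.
have [|y yG] := happ (rnorm w / (k + 1)); first by rewrite divr_gt0 // ltr_wpDl.
rewrite ltr_pdivlMr ?ltr_wpDl // => h.
by have := hw y yG; have := rnorm_ge0 (x - y); nra.
Qed.

Lemma rep_gaussian_space a x :
  gaussian_space eps rho x -> gaussian_space eps rho (rho a x).
Proof. by move=> xG b; rewrite !xG rep_scale xG !scalerA mulrC. Qed.

(** Moving [rho a] to the other side of the inner product gives [rho (star a)], which acts on
    Gaussian vectors as a scalar. *)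
Lemma rep_orthocomplement_gaussian_space a x :
  orthocomplement (gaussian_space eps rho) x ->
  orthocomplement (gaussian_space eps rho) (rho a x).
Proof.
move=> xV y yG; rewrite -(rep_star hrho) // yG dotZl.
by rewrite xV // mulr0.
Qed.

Lemma representation_restrict V : closed_subspace V ->
  (forall a x, V x -> V (rho a x)) -> representation V rho.
Proof.
move=> hV hinv; have [_ rb rl r1 rM rs] := hrho; split=> //.
- move=> a; have [_ h [M hM]] := rb a; split; first exact: hinv.
  + by move=> c x y _ _; exact: h.
  + by exists M => x _; exact: hM.
- by move=> c a b x _; exact: rl.
- by move=> x _; exact: r1.
- by move=> a b x _; exact: rM.
- by move=> a x y _ _; exact: rs.
Qed.

(** If [p] is the projection of [x], then [rho a x - eps a *: p = rho a (x - p)] stays orthogonal to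
    the Gaussian space. This is what makes the projection of a cocycle Gaussian. *)
Lemma orthoproj_rep a x :
  orthoproj (gaussian_space eps rho) (rho a x) =
  eps a *: orthoproj (gaussian_space eps rho) x.
Proof.
have hG := gaussian_space_closed_subspace.
have [Gp xp] := orthoprojP x hG.
apply: orthoproj_uniq => //; first exact: (closed_subspaceZ (eps a) hG Gp).
by rewrite -Gp -rep_sub; exact: rep_orthocomplement_gaussian_space.
Qed.

End GaussianSpace.

(** * From hermitian completions to Lévy-Khintchine decompositions *)

Section LevyKhintchine.
Variables (R : realType) (A : starAlgType R[i]) (eps : A -> R[i]).
Hypothesis heps : character eps.

(* A decomposition only needs the Gaussian part to be completed to a hermitian
   functional: the difference then completes the other part. *)
Lemma property_LK_of_hermitian_completion :
  (forall (H : hilbertType R[i]) (eta : A -> H), gaussian_cocycle eps eta ->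
    exists psi : A -> R[i],
      schurmann_triple eps setT (@eps_rep _ _ eps H) eta psi /\
      forall a, psi (star a) = (psi a)^*) ->
  property_LK eps.
Proof.
move=> hGC psi [psiL psi1 psiS psi_pos] H rho eta [[hrho heta _ psiM] _] /=.
set HG := gaussian_space eps rho.
have [eL e1 eM eS] := heps.
have hG : closed_subspace HG by exact: gaussian_space_closed_subspace.
have etaL := cocycle_linear heta.
pose P := orthoproj HG.
have PL : linear P by exact: orthoproj_linear.
have PG x : HG (P x) by have [] := orthoprojP x hG.
have PN x : orthocomplement HG (x - P x) by have [] := orthoprojP x hG.
have Prho a x : P (rho a x) = eps a *: P x by exact: orthoproj_rep.
have PetaM a b : P (eta (a * b)) = eps a *: P (eta b) + eps b *: P (eta a).
  by rewrite (cocycleM heta) addrC PL Prho addrC.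
have PetaL : linear (fun a => P (eta a)) by move=> c a b; rewrite etaL PL.
have hGauss : gaussian_cocycle eps (fun a => P (eta a)).
  by split=> // a b; rewrite PetaM.
have [psiG [[_ _ psiGL psiGM] psiGS]] := hGC H _ hGauss.
(* The cross terms vanish by orthogonality, so subtracting the identity for [psiG] from that for
   [psi] leaves the identity for the other part. *)
have eta_dot a b : dot (eta a) (eta b) = dot (P (eta a)) (P (eta b)) +
    dot (eta a - P (eta a)) (eta b - P (eta b)).
  have h1 := PN (eta b) _ (PG (eta a)).
  have h2 : dot (eta a - P (eta a)) (P (eta b)) = 0.
    by rewrite dot_conj PN ?conjC0.
  have dec (p q r s : H) : dot p s = 0 -> dot r q = 0 ->
      dot (r + p) (s + q) = dot p q + dot r s.
    by move=> ps rq; rewrite dotDl !dotDr ps rq; ring.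
  by have := dec _ _ _ _ h1 h2; rewrite !subrK.
pose psiN a := psi a - psiG a.
have psiNL : scalar psiN by move=> c a b; rewrite /psiN psiL psiGL; ring.
have psiNM a b : psiN (a * b) = psiN a * eps b + eps a * psiN b +
    dot (eta (star a) - P (eta (star a))) (eta b - P (eta b)).
  by rewrite /psiN psiM psiGM eta_dot; ring.
(* A hermitian functional in a Schürmann triple is generating: on the kernel of [eps], its value at
   [star a * a] is the squared norm of [xi a], and the product [1 * 1] gives [f 1 = 0]. *)
have gen (f : A -> R[i]) (V : set H) r (xi : A -> H) :
    schurmann_triple eps V r xi f ->
    (forall a, f (star a) = (f a)^*) -> generating_functional eps f.
  move=> [hr hxi fL fM] fS; split=> //.
  - have xi1 : xi 1 = 0.
      have := cocycleM hxi 1 1.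
      rewrite mulr1 (rep1 hr) ?e1 ?scale1r; last exact: cocycle_in hxi 1.
      by rewrite -{1}[xi 1]addr0 => /addrI <-.
    have := fM 1 1; rewrite mulr1 e1 xi1 dot0r addr0 mulr1 mul1r.
    by rewrite -{1}[f 1]addr0 => /addrI <-.
  - move=> a ea; rewrite fM eS ea conjC0 mulr0 mul0r !add0r starK dotxx.
    by rewrite exprn_ge0.
(* On [HG] the representation [rho] acts through [eps], so the completion over [eps_rep] is also one
   over [rho]. *)
have tripleG : schurmann_triple eps HG rho (fun a => P (eta a)) psiG.
  split=> //.
    by apply: representation_restrict => // a x; exact: rep_gaussian_space.
  by split=> // a b; rewrite PetaM PG.
have tripleN : schurmann_triple eps (orthocomplement HG) rho
    (fun a => eta a - P (eta a)) psiN.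
  split=> //.
  - apply: representation_restrict => //.
      exact: orthocomplement_closed_subspace.
    by move=> a x; exact: rep_orthocomplement_gaussian_space.
  - split=> [a|c a b|a b]; first exact: PN.
    + by rewrite etaL PL scalerBr opprD addrACA.
    + rewrite PetaM (cocycleM heta) (rep_sub hrho) PG scalerBr opprD.
      by rewrite addrACA.
exists psiG, psiN; split=> //; first exact: gen tripleG psiGS.
by apply: gen tripleN _ => a; rewrite /psiN psiS psiGS rmorphB.
Qed.
End LevyKhintchine.

Theorem theorem2p1 (R : realType) (d : nat) (F : 'M[R[i]]_d)
    (hF : F \in unitmx) (hgen : generic_mx F) :
  property_GC (counit hF) /\ property_LK (counit hF).
Proof.
split=> [H eta heta|].
  by have [psi [triple _]] := gaussian_cocycle_completion heta hgen; exists psi.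
apply: (property_LK_of_hermitian_completion (counit_character hF)) => H eta heta.
exact: gaussian_cocycle_completion heta hgen.
Qed.
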